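(* Let $s\ge 2$, $1\le d\le s$ and $1\le r\le \dim_K KV_{\le d}$ be integers with $d+r-2<s$. If $f_1,\dots,f_r\in KV_{\le d}$ are linearly independent over $K$, then $$|V_T(f_1,\dots,f_r)|\le (q-1)^s-(q-2)^{d-1}(q-1)^{s-d-r+1}\left[(q-1)^r-1\right].$$
   Context: $K=\mathbb{F}_q$ is the finite field with $q$ elements, $q$ a power of a prime, and $S=K[t_1,\dots,t_s]$. A monomial $t_1^{a_1}\cdots t_s^{a_s}$ is square-free if all $a_i\in\{0,1\}$. $KV_{\le d}$ is the $K$-span of all square-free monomials of $S$ of degree at most $d$ (so $\dim_K KV_{\le d}=\sum_{i=0}^d\binom{s}{i}$). $T=(\mathbb{F}_q^* )^s$ is the affine torus, and $V_T(f_1,\dots,f_r)$ is the set of common zeros of $f_1,\dots,f_r$ in $T$. *)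

(* Defs.v *)
From HB Require Import structures.
From mathcomp Require Import all_boot all_order all_algebra.
From mathcomp Require Export mpoly.

Set Implicit Arguments.
Unset Strict Implicit.
Unset Printing Implicit Defensive.

Import GRing.Theory.
Local Open Scope ring_scope.

Definition squarefree_mnm (s : nat) (m : 'X_{1..s}) : bool :=
  [forall i, (m i <= 1)%N].

(* Membership is phrased with the support so that it is decidable;
   [sqfree_mpolyP] shows that this is the span of the square-free monomials
   of degree at most [d]. *)
Definition sqfree_mpoly_pred (s : nat) (K : fieldType) (d : nat) :=
  fun p : {mpoly K[s]} =>
    all [pred m | squarefree_mnm m && (mdeg m <= d)%N] (msupp p).
Arguments sqfree_mpoly_pred _ _ _ _ /.
Definition sqfree_mpoly (s : nat) (K : fieldType) (d : nat) :=
  [qualify a p | @sqfree_mpoly_pred s K d p].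

Section SquareFreeSpace.
Context (s : nat) (K : fieldType) (d : nat).

Lemma sqfree_mpolyE (p : {mpoly K[s]}) :
  (p \is a @sqfree_mpoly s K d) =
  all [pred m | squarefree_mnm m && (mdeg m <= d)%N] (msupp p).
Proof. by []. Qed.

Lemma sqfree_mpoly_submod_closed :
  submod_closed (@sqfree_mpoly s K d).
Proof.
split=> [|c p q]; first by rewrite sqfree_mpolyE msupp0.
rewrite !sqfree_mpolyE => /allP hp /allP hq; apply/allP=> m.
move/msuppD_le; rewrite mem_cat => /orP[/msuppZ_le|]; [exact: hp|exact: hq].
Qed.

HB.instance Definition _ :=
  GRing.isSubmodClosed.Build K {mpoly K[s]} (@sqfree_mpoly_pred s K d)
    sqfree_mpoly_submod_closed.

Lemma sqfree_mpolyX (m : 'X_{1..s}) :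
  squarefree_mnm m -> (mdeg m <= d)%N ->
  ('X_[m] : {mpoly K[s]}) \is a @sqfree_mpoly s K d.
Proof. by move=> sm dm; rewrite sqfree_mpolyE msuppX /= sm dm. Qed.

Lemma sqfree_mpoly_sum (p : {mpoly K[s]}) : p \is a @sqfree_mpoly s K d ->
  p = \sum_(m : 'X_{1..s < d.+1} | squarefree_mnm m) p@_m *: 'X_[m].
Proof.
rewrite sqfree_mpolyE => /allP hp; apply/mpolyP=> m; rewrite raddf_sum /=.
have [m_in|m_notin] := boolP (m \in msupp p).
  have /andP[sm dm] := hp _ m_in.
  rewrite (bigD1 (BMultinom (dm : (mdeg m < d.+1)%N))) //=.
  rewrite mcoeffZ mcoeffX eqxx mulr1.
  rewrite big1 ?addr0 // => m' /andP[_ ne].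
  rewrite mcoeffZ mcoeffX.
  by move: ne; rewrite bmeqP /= => /negbTE ->; rewrite mulr0.
rewrite big1 ?memN_msupp_eq0 // => m' _; rewrite mcoeffZ mcoeffX.
by case: eqP => [->|_]; rewrite ?(memN_msupp_eq0 m_notin) ?mul0r ?mulr0.
Qed.

Lemma sqfree_mpolyP (p : {mpoly K[s]}) :
  reflect (exists c : 'X_{1..s < d.+1} -> K,
             p = \sum_(m : 'X_{1..s < d.+1} | squarefree_mnm m) c m *: 'X_[m])
          (p \is a @sqfree_mpoly s K d).
Proof.
apply: (iffP idP) => [/sqfree_mpoly_sum ->|[c ->]].
  by exists (fun m => p@_m).
apply: rpred_sum => m sm; apply/rpredZ/sqfree_mpolyX => //.
by rewrite -ltnS; exact: bmdeg.
Qed.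

(* The space KV_{<= d}, as a finite-dimensional vector space over K. *)
Record KV := MkKV {
  mpoly_of_KV :> {mpoly K[s]};
  _ : mpoly_of_KV \is a @sqfree_mpoly s K d
}.

HB.instance Definition _ := [isSub for @mpoly_of_KV].
HB.instance Definition _ := [Choice of KV by <:].
HB.instance Definition _ := [SubChoice_isSubLmodule of KV by <:].

Definition sqfree_mnms : {set 'X_{1..s < d.+1}} :=
  [set m | squarefree_mnm (val m)].

Lemma KV_vecaxiom : Vector.axiom #|sqfree_mnms| KV.
Proof.
pose M (i : 'I_#|sqfree_mnms|) : 'X_{1..s} := val (enum_val i).
exists (fun p : KV => \row_i (val p)@_(M i)) => [c p q|].
  by apply/rowP=> i; rewrite !mxE /= mcoeffD mcoeffZ.
have sM i : squarefree_mnm (M i).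
  by have := enum_valP i; rewrite inE.
pose g (r : 'rV[K]_#|sqfree_mnms|) : {mpoly K[s]} := \sum_i r 0 i *: 'X_[M i].
have gP r : g r \is a @sqfree_mpoly s K d.
  apply: rpred_sum => i _; apply/rpredZ/sqfree_mpolyX; first exact: sM.
  by rewrite -ltnS; exact: bmdeg.
exists (fun r => MkKV (gP r)) => [p|r].
  apply/val_inj; rewrite /= [RHS](sqfree_mpoly_sum (valP p)) /g.
  rewrite [RHS](eq_bigl (fun m => m \in sqfree_mnms)) => [|m]; last by rewrite !inE.
  by rewrite [RHS]big_enum_val; apply: eq_bigr => i _; rewrite mxE.
apply/rowP=> j; rewrite mxE /= raddf_sum (bigD1 j) //=.
rewrite mcoeffZ mcoeffX eqxx mulr1 big1 ?addr0 // => i ne_ij.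
rewrite mcoeffZ mcoeffX; case: eqP => [e|_]; last by rewrite mulr0.
by case/eqP: ne_ij; apply/enum_val_inj/val_inj.
Qed.

HB.instance Definition _ := Lmodule_hasFinDim.Build K KV KV_vecaxiom.

Lemma dim_KV : \dim {:KV} = (\sum_(i < d.+1) 'C(s, i))%N.
Proof.
rewrite dimvf -[LHS]/(#|sqfree_mnms|).
pose supp (m : 'X_{1..s < d.+1}) : {set 'I_s} := [set i | val m i == 1%N].
have mE (m : 'X_{1..s}) : squarefree_mnm m ->
    forall i, m i = (m i == 1%N) :> nat.
  by move=> /forallP sm i; move: (sm i); case: (m i) => [|[]].
have supp_inj : {in sqfree_mnms &, injective supp}.
  move=> m m'; rewrite !inE => sm sm' /setP e; apply/val_inj/mnmP => i.
  by rewrite (mE _ sm) (mE _ sm'); have := e i; rewrite !inE => ->.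
have degE (m : 'X_{1..s}) : squarefree_mnm m ->
    mdeg m = #|[set i | m i == 1%N]|.
  move=> sm; rewrite mdegE -sum1_card [RHS]big_mkcond /=.
  by apply: eq_bigr => i _; rewrite inE {1}(mE _ sm); case: (m i == 1%N).
rewrite -(card_in_imset supp_inj).
have -> : supp @: sqfree_mnms = [set A : {set 'I_s} | (#|A| < d.+1)%N].
  apply/setP=> A; apply/imsetP/idP => [[m + ->]|].
    by rewrite !inE => sm; rewrite /supp -degE // bmdeg.
  rewrite inE => dA; pose m : 'X_{1..s} := [multinom (i \in A : nat) | i < s].
  have sm : squarefree_mnm m.
    by apply/forallP=> i; rewrite mnmE; case: (i \in A).
  have mA : [set i | m i == 1%N] = A.
    by apply/setP=> i; rewrite inE mnmE; case: (i \in A).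
  have dm : (mdeg m < d.+1)%N by rewrite degE // mA.
  by exists (BMultinom dm); rewrite ?inE //= /supp mA.
rewrite -sum1_card.
rewrite (partition_big (fun A : {set 'I_s} => inord #|A| : 'I_d.+1) xpredT) //=.
apply: eq_bigr => i _; rewrite sum1_card -[in RHS](card_ord s) -cardsT.
rewrite -cards_draws -cardsE; apply: eq_card => A.
rewrite !inE subsetT /=; apply/andP/eqP => [[lA /eqP <-]|eA].
  by rewrite inordK; move: lA; rewrite inE.
by rewrite inE eA ltn_ord inord_val.
Qed.

End SquareFreeSpace.

(* V_T(f_1, ..., f_r), with T the affine torus (K^* )^s. *)
Definition torus_zeros (s : nat) (K : finFieldType) (r : nat)
    (f : 'I_r -> {mpoly K[s]}) : {set s.-tuple K} :=
  [set x : s.-tuple K |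
     [forall i, tnth x i != 0] && [forall j, (f j).@[tnth x] == 0]].

(* Main.v *)
(** The points of the torus T where some f_j is nonzero form a set W, and we
    bound |W| from below by a footprint argument.  The span of the f_j contains
    polynomials with r distinct leading monomials, which are square-free of
    degree at most d.  Multiplying them by monomials yields, for each exponent
    a in the box [0, q-2]^s whose support contains the support of one of these
    monomials, a polynomial with leading exponent a that vanishes on T outside
    W.  These polynomials are linearly independent as functions on T, so |W|
    is at least the number of such a.  To count them, let A be of minimal
    cardinality among r distinct sets of size at most d: each other set B has
    an element outside A, so the exponents that are nonzero on A and zero at
    these at most r-1 chosen elements are not counted by the other sets.
    Removing A and iterating gives the bound. *)

Require Import Defs.
From HB Require Import structures.
From mathcomp Require Import all_boot all_order all_algebra.
From mathcomp Require Import all_fingroup all_solvable all_field.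
From mathcomp Require Import zify.

Set Implicit Arguments.
Unset Strict Implicit.
Unset Printing Implicit Defensive.

Import Order.TTheory GRing.Theory Num.Theory.
Local Open Scope ring_scope.

(** * Counting exponents with prescribed support conditions *)

(** A coordinate has [u] choices on [A], one on [C] and [u.+1] elsewhere, so the count is a product;
    making [A] smaller than [d] or [C] smaller than [c] can only increase it. *)
Lemma card_ffun_pattern (u s d c : nat) (A C : {set 'I_s}) :
  [disjoint A & C] -> (#|A| <= d)%N -> (#|C| <= c)%N -> (d + c <= s)%N ->
  (u ^ d * u.+1 ^ (s - d - c) <=
   #|[set a : {ffun 'I_s -> 'I_u.+1} |
        (A \subset [set i | a i != 0%N :> nat])
        && [disjoint C & [set i | a i != 0%N :> nat]]]|)%N.
Proof.
move=> dAC lA lC lds.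
pose F (i : 'I_s) : pred 'I_u.+1 :=
  if i \in A then [pred x | x != ord0] else
  if i \in C then pred1 ord0 else predT.
have cardF : (u ^ d * u.+1 ^ (s - d - c) <= \prod_i #|F i|)%N.
  pose e (i : 'I_s) := if i \in A then u else if i \in C then 1%N else u.+1.
  have -> : (\prod_i #|F i| = \prod_i e i)%N.
    apply: eq_bigr => i _; rewrite /F /e; case: ifP => _.
      by have := cardC1 (ord0 : 'I_u.+1); rewrite card_ord.
    by case: ifP => _; rewrite ?card1 ?card_ord.
  rewrite (bigID [in A]) /= (eq_bigr (fun=> u)) => [|i]; last first.
    by rewrite /e => ->.
  rewrite prod_nat_const (bigID [in C]) /=.
  rewrite big1 => [|i /andP[/negbTE iA iC]]; last first.
    by rewrite /e iA iC.
  rewrite mul1n.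
  rewrite (eq_bigr (fun=> u.+1)) => [|i /andP[/negbTE iA /negbTE iC]]; last first.
    by rewrite /e iA iC.
  rewrite prod_nat_const.
  have -> : #|[pred i | (i \notin A) && (i \notin C)]| = (s - #|A| - #|C|)%N.
    have := cardsC (A :|: C).
    rewrite cardsU disjoint_setI0 // cards0 subn0 card_ord.
    have -> : #|~: (A :|: C)| = #|[pred i | (i \notin A) && (i \notin C)]|.
      by apply: eq_card => i; rewrite !inE negb_or.
    lia.
  rewrite -{1}(subnKC lA) expnD -!mulnA leq_mul2l; apply/orP; right.
  apply: leq_trans (_ : u.+1 ^ (d - #|A|) * u.+1 ^ (s - d - c) <= _)%N.
    have wexp k : (u ^ k <= u.+1 ^ k)%N.
      by elim: k => // k h; rewrite !expnS leq_mul.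
    by rewrite leq_mul2r wexp orbT.
  rewrite -expnD leq_pexp2l //; lia.
apply: leq_trans cardF _; rewrite -big_enum -(big_map (fun i => #|F i|) xpredT id).
rewrite -[X in (X <= _)%N]foldrE -card_family.
apply/subset_leq_card/subsetP => a /familyP aF; rewrite inE; apply/andP; split.
  by apply/subsetP => i iA; have := aF i; rewrite /F iA !inE.
rewrite disjoint_subset; apply/subsetP => i iC.
have := aF i; rewrite /F (negbTE (_ : i \notin A)) ?iC.
  by rewrite !inE => /eqP->.
by rewrite (disjointFl dAC).
Qed.

Lemma card_upset (u s d : nat) (F : {set {set 'I_s}}) :
  (forall A, A \in F -> #|A| <= d)%N -> (d + #|F| <= s.+1)%N ->
  (\sum_(j < #|F|) u ^ d * u.+1 ^ (s - d - j) <=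
   #|[set a : {ffun 'I_s -> 'I_u.+1} |
       [exists A in F, A \subset [set i | a i != 0%N :> nat]]]|)%N.
Proof.
have [r] := ubnP #|F|; elim: r F => // r IH F ltr Fd Fs.
have [->|[A0 A0F]] := set_0Vmem F; first by rewrite cards0 big_ord0.
case: (arg_minnP (fun A : {set 'I_s} => #|A|) A0F) => A AF Amin.
have {}AF : A \in F by [].
pose G := F :\ A; have FG : #|F| = #|G|.+1 by rewrite (cardsD1 A) AF.
(* One element of B outside A for each B in G. *)
pose C := [set i | Some i \in [set [pick i in B :\: A] | B in G]].
have CA : [disjoint A & C].
  rewrite disjoint_sym disjoint_subset; apply/subsetP => i; rewrite !inE.
  by case/imsetP => B _; case: pickP => // k; rewrite !inE => /andP[kA _] [->].
have cC : (#|C| <= #|G|)%N.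
  rewrite -(card_imset (mem C) (@Some_inj _)).
  pose pt (B : {set 'I_s}) := [pick i in B :\: A].
  apply: leq_trans (leq_imset_card pt (mem G)).
  by apply/subset_leq_card/subsetP => _ /imsetP[i + ->]; rewrite inE.
have CG B : B \in G -> exists2 i, i \in C & i \in B.
  move=> BG; case pi: [pick i in B :\: A] => [i|].
    exists i; last by move: pi; case: pickP => // k; rewrite !inE => /andP[_ +] [<-].
    by rewrite inE; apply/imsetP; exists B.
  (* If nothing is picked, [B] lies in [A], and minimality of [#|A|] forces [B = A], which [G]
     excludes. *)
  move: pi; case: pickP => // BA _.
  have sBA : B \subset A by rewrite -setD_eq0; apply/eqP/setP=> k; rewrite BA inE.
  move: BG; rewrite !inE => /andP[/eqP nBA BF]; case: nBA.
  by apply/eqP; rewrite eqEcard sBA; apply: Amin.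
rewrite FG big_ord_recr /=.
(* By induction [G] accounts for the terms [j < #|G|]; the exponents nonzero on [A] and zero on [C]
   give the last term. *)
have hA := @card_ffun_pattern u s d #|G| A C CA (Fd _ AF) cC _.
apply: leq_trans (leq_add (IH G _ _ _) (hA _)) _; rewrite -?FG //; try lia.
  by move=> B; rewrite inE => /andP[_ /Fd].
rewrite -cardsUI [X in (_ + X)%N](_ : _ = 0)%N ?addn0.
  apply/subset_leq_card/subsetP => a; rewrite !inE => /orP[/exists_inP[B]|/andP[h _]].
    by rewrite inE => /andP[_ BF] h; apply/exists_inP; exists B.
  by apply/exists_inP; exists A.
(* No exponent is counted twice: every member of [G] meets [C], where the newly counted exponents
   vanish. *)
apply/eqP; rewrite cards_eq0 -subset0; apply/subsetP => a; rewrite !inE.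
case/andP=> /exists_inP[B /CG[i iC iB] /subsetP/(_ _ iB) ia] /andP[_].
by move=> /disjointFr /(_ iC); rewrite ia.
Qed.

(** * Power sums and nonvanishing on the torus *)

Lemma card_nonzero (K : finFieldType) : #|[pred x : K | x != 0]| = #|K|.-1.
Proof. by rewrite -(cardC1 (0 : K)); apply: eq_card => x; rewrite !inE. Qed.

(** Scaling by [y] permutes the nonzero elements and multiplies the sum by [y ^+ k]. Some [y] has
    [y ^+ k != 1], since there are at most [k] roots of unity of order dividing [k]. *)
Lemma sum_nonzero_expf (K : finFieldType) (k : nat) : (0 < k < #|K|.-1)%N ->
  \sum_(x : K | x != 0) x ^+ k = 0.
Proof.
case/andP=> k0 lk.
have [y y0 yk] : exists2 y : K, y != 0 & y ^+ k != 1.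
  case: (pickP [pred y : K | (y != 0) && (y ^+ k != 1)]) => [y /andP[] | H].
    by exists y.
  have := @max_unity_roots K k (enum [pred x : K | x != 0]) k0.
  rewrite enum_uniq -cardE card_nonzero leqNgt lk => noroots.
  suff /noroots/(_ isT) : all k.-unity_root (enum [pred x : K | x != 0]) by [].
  apply/allP => x; rewrite mem_enum inE => x0; apply/unity_rootP/eqP.
  by have := H x; rewrite /= x0 => /negbFE.
apply/eqP; have /eqP : y ^+ k * (\sum_(x : K | x != 0) x ^+ k) =
    \sum_(x : K | x != 0) x ^+ k.
  rewrite [RHS](reindex_inj (mulfI y0)) mulr_sumr.
  by apply: eq_big => x; rewrite ?mulf_eq0 ?(negbTE y0) // exprMn.
rewrite -subr_eq0 -{2}[\sum_(_ | _) _]mul1r -mulrBl mulf_eq0.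
by rewrite subr_eq0 (negbTE yk).
Qed.

(** Each of the [#|K|.-1] summands is 1, and [#|K|] is zero in [K]. *)
Lemma sum_nonzero_expf_card (K : finFieldType) :
  \sum_(x : K | x != 0) x ^+ #|K|.-1 = - 1.
Proof.
have K0 : (0 < #|K|)%N by apply/card_gt0P; exists 0.
rewrite (eq_bigr (fun=> 1)) => [|x x0]; last first.
  by apply: (mulfI x0); rewrite -exprS prednK // expf_card mulr1.
rewrite sumr_const card_nonzero.
have : (1 : K) *+ #|K| = 0.
  by rewrite -FinRing.Theory.zmodXgE -cardsT expg_cardG ?inE.
by rewrite -{1}(prednK K0) mulrS => /eqP; rewrite addrC addr_eq0 => /eqP.
Qed.

(* The sum over T of x^(q-1-a) p(x) picks out, up to sign, the coefficient of
   x^a: any other monomial x^m of p has m_i < a_i for some i by the degree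
   bound, and then the i-th power sum has exponent strictly between 0 and q-1. *)
Lemma torus_nonvanishing (K : finFieldType) (s : nat) (p : {mpoly K[s]})
    (a : 'X_{1..s}) :
  (forall i, (a i < #|K|.-1)%N) -> p@_a != 0 ->
  (forall m, m \in msupp p -> (mdeg m <= mdeg a)%N) ->
  exists2 x : {ffun 'I_s -> K}, forall i, x i != 0 & p.@[x] != 0.
Proof.
move=> box pa dmax; set n := #|K|.-1.
case: (pickP [pred x : {ffun 'I_s -> K} |
               [forall i, x i != 0] && (p.@[x] != 0)]).
  by move=> x /andP[/forallP]; exists x.
move=> H; case/negP: pa; apply/eqP.
pose mom k := \sum_(x : K | x != 0) x ^+ k.
have : \sum_(x : {ffun 'I_s -> K} |
           x \in family (fun=> [pred y : K | y != 0]))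
     (\prod_i x i ^+ (n - a i)) * p.@[x] = 0.
  apply: big1 => x /familyP xT; have := H x; rewrite /=.
  have -> /= : [forall i, x i != 0] by apply/forallP.
  by move/negbFE/eqP->; rewrite mulr0.
rewrite (eq_bigr (fun x : {ffun 'I_s -> K} => \sum_(m <- msupp p)
    p@_m * \prod_i x i ^+ (n - a i + m i))) => [|x _]; last first.
  rewrite mevalE mulr_sumr; apply: eq_bigr => m _; rewrite mulrCA -big_split /=.
  by congr (_ * _); apply: eq_bigr => i _; rewrite exprD.
rewrite exchange_big /=.
(* The sum of a monomial over the torus factors into one-variable power sums. *)
rewrite (eq_bigr (fun m : 'X_{1..s} => p@_m * \prod_i mom (n - a i + m i)%N))
    => [E|m _]; last first.
  by rewrite -mulr_sumr -(bigA_distr_big_dep (fun=> [pred y : K | y != 0])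
                            (fun i y => y ^+ (n - a i + m i))).
have [an|an] := boolP (a \in msupp p); last by rewrite memN_msupp_eq0.
move: E; rewrite (bigD1_seq a) ?msupp_uniq //= [X in _ + X]big1_seq.
  rewrite addr0 => /eqP; rewrite mulf_eq0 => /orP[/eqP //|].
  (* For [m = a] every exponent is [n], so the product of power sums is a sign. *)
  rewrite (eq_bigr (fun=> -1)); first by rewrite prodr_const signr_eq0.
  by move=> i _; rewrite subnK ?(ltnW (box i)) // /mom sum_nonzero_expf_card.
move=> m /andP[ma mp].
have [i lti] : exists i, (m i < a i)%N.
  case: (pickP [pred i | m i < a i]%N) => [i|Hi]; first by exists i.
  have lem i : (a i <= m i)%N by rewrite leqNgt; have := Hi i => /= ->.
  case/eqP: ma; apply/mnmP => i; apply/eqP; rewrite eqn_leq lem andbT leqNgt.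
  apply/negP => lt; have := dmax _ mp; rewrite leqNgt => /negP; apply.
  rewrite !mdegE (bigD1 i) //= [X in (_ < X)%N](bigD1 i) //= -addSn leq_add //.
  exact: leq_sum.
rewrite (bigD1 i) //= /mom sum_nonzero_expf ?mul0r ?mulr0 //.
have := box i; rewrite -/n; lia.
Qed.

(** * Distinct leading monomials and linear independence *)

(** The matrix of values of the [g a] on [W] has independent rows: a nontrivial relation would give
    a polynomial vanishing on the whole torus, against [torus_nonvanishing] at its leading
    monomial. *)
Lemma card_leads_le (K : finFieldType) (s : nat) (W : {set s.-tuple K})
    (I : finType) (g : I -> {mpoly K[s]}) :
  injective (fun a => mlead (g a)) -> (forall a, g a != 0) ->
  (forall a i, (mlead (g a) i < #|K|.-1)%N) ->
  (forall a x, (forall i, tnth x i != 0) -> x \notin W -> (g a).@[tnth x] = 0) ->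
  (#|I| <= #|W|)%N.
Proof.
move=> ginj g0 box gW.
pose M : 'M[K]_(#|I|, #|W|) :=
  \matrix_(i, k) (g (enum_val i)).@[tnth (enum_val k)].
suff /eqP <- : row_free M by exact: rank_leq_col.
apply: inj_row_free => v vM; apply/eqP/negPn/negP => /rV0Pn[i0 vi0].
pose p := \sum_i v 0 i *: g (enum_val i).
have pT (x : s.-tuple K) : (forall i, tnth x i != 0) -> p.@[tnth x] = 0.
  move=> xT; rewrite raddf_sum /=; have [xW|xW] := boolP (x \in W).
    have := congr1 (fun z : 'rV_#|W| => z 0 (enum_rank_in xW x)) vM.
    rewrite !mxE => h; rewrite -[RHS]h; apply: eq_bigr => i _.
    by rewrite mevalZ mxE enum_rankK_in.
  by apply: big1 => i _; rewrite mevalZ gW ?mulr0.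
pose lead (i : 'I_#|I|) := mlead (g (enum_val i)).
(* The largest leading monomial with nonzero coefficient cannot cancel, as the others are distinct
   from it. *)
case: (@arg_maxP _ _ _ i0 (fun i => v 0 i != 0) lead) => // i vi imax.
have {}imax j : v 0 j != 0 -> (lead j <= lead i)%O by exact: imax.
have [|||x xT /eqP[]] := @torus_nonvanishing K s p (mlead (g (enum_val i))).
- exact: box.
- rewrite raddf_sum (bigD1 i) //= mcoeffZ big1 ?addr0.
    by rewrite mulf_neq0 // mleadc_eq0.
  move=> j ji; rewrite mcoeffZ.
  have [->|vj] := eqVneq (v 0 j) 0; first by rewrite mul0r.
  rewrite mcoeff_gt_mlead ?mulr0 // lt_neqAle imax // andbT.
  by apply: contra_neq ji => /ginj/enum_val_inj.
(* The monomial order refines the degree. *)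
- move=> m mp; apply: lemc_mdeg; apply: le_trans (msupp_le_mlead mp) _.
  apply: le_trans (mlead_sum_le _ _ _) _; apply/joinsP => j _.
  have [->|vj] := eqVneq (v 0 j) 0; first by rewrite scale0r mlead0 le0x.
  by apply: le_trans (mleadZ_le _ _) _; apply: imax.
rewrite -(pT [tuple x k | k < s]) => [|k]; last by rewrite tnth_mktuple.
by apply: meval_eq => k; rewrite tnth_mktuple.
Qed.

(** The codomain [K^o] is [K] as a one-dimensional space over itself, so that rank-nullity
    applies. *)
Definition KV_coef (s : nat) (K : fieldType) (d : nat) (m : 'X_{1..s})
    (g : KV s K d) : K^o := (val g)@_m.

HB.instance Definition _ (s : nat) (K : fieldType) (d : nat) (m : 'X_{1..s}) :=
  GRing.isLinear.Build K (KV s K d) K^o *:%R (@KV_coef s K d m)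
    (fun c g h => linearP (mcoeff m) c (val g) (val h)).

(** Gaussian elimination: the coefficient at the leading monomial of some nonzero [g] is a nonzero
    functional on [U]. Its kernel has codimension one and no element with that leading monomial. *)
Lemma distinct_leads (s : nat) (K : fieldType) (d : nat) (U : {vspace KV s K d}) :
  exists ms : seq 'X_{1..s}, [/\ uniq ms, size ms = \dim U &
    forall m, m \in ms -> exists2 g : KV s K d,
      g \in U & val g != 0 /\ mlead (val g) = m].
Proof.
have [n] := ubnP (\dim U); elim: n U => // n IH U ltn.
have [U0|Un0] := eqVneq (\dim U) 0%N; first by exists [::]; rewrite U0.
have [g gU g0] : exists2 g, g \in U & g != 0.
  by exists (vpick U); [exact: memv_pick | rewrite vpick0 -dimv_eq0].
have vg0 : val g != 0 by apply: contra_neq g0 => h; apply: val_inj.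
pose m := mlead (val g).
pose phi : 'Hom(KV s K d, K^o) := linfun (@KV_coef s K d m).
pose U' := (U :&: lker phi)%VS.
have dimU : \dim U = (\dim U').+1.
  rewrite -(limg_ker_dim phi U) -/U' -addn1; congr (_ + _)%N.
  apply/eqP; rewrite eqn_leq; apply/andP; split.
    by rewrite (leq_trans (dimvS (subvf _))) // dimvf.
  rewrite lt0n dimv_eq0; apply/negP => /eqP phi0.
  have := memv_img phi gU; rewrite phi0 memv0 lfunE /= /KV_coef.
  by rewrite mleadc_eq0 (negbTE vg0).
have [|ms [ums sms hms]] := IH U'; first by rewrite -ltnS -dimU.
exists (m :: ms); rewrite /= ums sms dimU; split=> // [|m'].
  rewrite andbT; apply/negP => /hms[h]; rewrite memv_cap memv_ker lfunE /= /KV_coef.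
  by move=> /andP[_ hm] [h0 hmm]; rewrite -hmm mleadc_eq0 (negbTE h0) in hm.
rewrite inE => /orP[/eqP->|/hms[h]]; first by exists g.
by rewrite memv_cap => /andP[hU _] ?; exists h.
Qed.

(** * Counting torus points and the final bound *)

Lemma card_torus (s : nat) (K : finFieldType) :
  #|[set x : s.-tuple K | [forall i, tnth x i != 0]]| = (#|K|.-1 ^ s)%N.
Proof.
have e : injective (fun x : {ffun 'I_s -> K} => [tuple x i | i < s]).
  move=> x y /(congr1 (@tnth _ _)) h; apply/ffunP=> i.
  by have := congr1 (@^~ i) h; rewrite !tnth_mktuple.
rewrite -[in RHS](card_ord s) -(cardC1 (0 : K)) -card_ffun_on -(card_imset _ e).
apply: eq_card => x; rewrite inE; apply/forallP/imsetP => [xT|[y /ffun_onP yT ->] i].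
  exists [ffun i => tnth x i]; first by apply/ffun_onP => i; rewrite ffunE; exact: xT.
  by apply: eq_from_tnth => i; rewrite tnth_mktuple ffunE.
by rewrite tnth_mktuple; exact: yT.
Qed.

Lemma card_torus_nonzeros (s d : nat) (K : finFieldType) (r : nat)
    (f : r.-tuple (KV s K d)) : free f -> (d + r <= s.+1)%N ->
  (\sum_(j < r) #|K|.-2 ^ d * #|K|.-1 ^ (s - d - j) <=
   #|[set x : s.-tuple K | [forall i, tnth x i != 0%R]] :\:
      torus_zeros (fun j => tnth f j : {mpoly K[s]})|)%N.
Proof.
move=> ff drs; set W := _ :\: _.
(* With [#|K| = u.+2], the exponents in the box are the functions into ['I_u.+1]. *)
have [u Ku] : exists u, #|K| = u.+2.
  by have := finNzRing_gt1 K; case: #|K| => [|[|u]] // _; exists u.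
rewrite Ku /=.
have [ms [ums sms hms]] := distinct_leads <<f>>%VS.
have {}sms : size ms = r by rewrite sms; move: ff; rewrite /free size_tuple => /eqP.
pose supp (m : 'X_{1..s}) := [set i | m i != 0%N].
have msP m : m \in ms -> squarefree_mnm m && (mdeg m <= d)%N.
  case/hms=> g _ [g0 <-]; have := valP g; rewrite sqfree_mpolyE => /allP; apply.
  exact: mlead_supp.
have sq m i : m \in ms -> m i = (i \in supp m) :> nat.
  case/msP/andP=> /forallP/(_ i) + _; rewrite inE; by case: (m i) => [|[]].
pose F := [set:: map supp ms].
have cF : #|F| = r.
  rewrite cardsE -sms -(size_map supp ms); apply/card_uniqP.
  rewrite map_inj_in_uniq // => m m' mm mm' e; apply/mnmP => i.
  by rewrite (sq _ _ mm) (sq _ _ mm') e.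
have FP A : A \in F -> exists2 m, m \in ms & A = supp m by rewrite inE => /mapP.
have Fd A : A \in F -> (#|A| <= d)%N.
  move=> /FP[m mm ->]; have /andP[_] := msP _ mm; apply: leq_trans.
  rewrite mdegE -sum1_card big_mkcond /= leq_sum // => i _.
  by rewrite (sq _ _ mm); case: (_ \in _).
have := @card_upset u s d F Fd; rewrite cF => /(_ drs) /leq_trans; apply.
set E := [set a | _]; rewrite -card_sig.
pose mnm (a : {ffun 'I_s -> 'I_u.+1}) : 'X_{1..s} :=
  [multinom (a i : nat) | i < s].
have exg (a : {a | a \in E}) : exists p : {mpoly K[s]},
  [/\ p != 0, mlead p = mnm (val a) & forall x : s.-tuple K,
       (forall i, tnth x i != 0) -> x \notin W -> p.@[tnth x] = 0].
  case: a => a /= /[!inE] /exists_inP[_ /FP[m mm ->] /subsetP sub].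
  have [g gU [g0 lg]] := hms _ mm.
  have X0 : 'X_[mnm a - m] != 0 :> {mpoly K[s]} by rewrite -msupp_eq0 msuppX.
  (* The subtraction is exact because [m] is square-free with support inside that of [a]. *)
  exists ('X_[mnm a - m] * val g); split.
  - by rewrite mulf_neq0.
  - rewrite mleadM // mleadXm lg submK //; apply/mnm_lepP => i.
    rewrite (sq _ _ mm) mnmE; case: (boolP (i \in supp m)) => // /sub.
    by rewrite inE lt0n.
  move=> x xT; rewrite !inE negb_and negbK => /orP[/andP[_ /forallP fx]|]; last first.
    by case/negP; apply/forallP.
  rewrite mevalM (coord_span gU) !raddf_sum /= big1 ?mulr0 // => j _.
  by apply: etrans (mevalZ _ _ _) _; rewrite -tnth_nth (eqP (fx j)) mulr0.
have [g gP] := fin_all_exists exg.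
apply: (card_leads_le (g := g)).
- move=> a b; case: (gP a) => _ -> _; case: (gP b) => _ -> _ /mnmP ab.
  by apply/val_inj/ffunP => i; apply/val_inj; have := ab i; rewrite !mnmE.
- by move=> a; case: (gP a).
- by move=> a i; case: (gP a) => _ -> _; rewrite mnmE Ku.
- by move=> a; case: (gP a).
Qed.

(** Reversed, the sum is geometric with ratio [u.+1]; one factor [u] of [u ^ d] is the ratio minus
    one. *)
Lemma sum_geometric_expn (u s d r : nat) : (0 < d)%N -> (d + r <= s.+1)%N ->
  (\sum_(j < r) u ^ d * u.+1 ^ (s - d - j) =
   u ^ (d - 1) * u.+1 ^ (s + 1 - (d + r)) * (u.+1 ^ r - 1))%N.
Proof.
move=> d0 drs; rewrite subn1 [(u.+1 ^ r - 1)%N]subn1 predn_exp /=.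
rewrite (reindex_inj rev_ord_inj) /=.
rewrite mulnACA -expnSr prednK // !big_distrr /=.
apply: eq_bigr => j _; rewrite -expnD; congr (_ ^ _ * _ ^ _)%N.
have := ltn_ord j; lia.
Qed.

Theorem theorem3p9 (K : finFieldType) (q s d r : nat)
  (hq : #|K| = q)
  (hs : (2 <= s)%N)
  (hd : (1 <= d <= s)%N)
  (hr : (1 <= r <= \dim {:KV s K d})%N)
  (hdr : (d + r - 2 < s)%N)
  (f : r.-tuple (KV s K d))
  (hf : free f) :
  (#|torus_zeros (fun j => tnth f j : {mpoly K[s]})|%:Z
     <= (q%:Z - 1) ^+ s
        - (q%:Z - 2) ^+ (d - 1) * (q%:Z - 1) ^+ (s + 1 - (d + r))
          * ((q%:Z - 1) ^+ r - 1)).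
Proof.
case/andP: hd hr => d0 _ /andP[r0 _].
have drs : (d + r <= s.+1)%N by lia.
have := card_torus_nonzeros hf drs.
have [u Ku] : exists u, #|K| = u.+2.
  by have := finNzRing_gt1 K; case: #|K| => [|[|u]] // _; exists u.
rewrite cardsD (setIidPr _); last by apply/subsetP => x; rewrite !inE => /andP[].
rewrite card_torus -hq Ku sum_geometric_expn //=.
have -> : u.+2%:Z - 1 = u.+1%:Z by lia.
have -> : u.+2%:Z - 2 = u%:Z by lia.
have PoszX m k : m%:Z ^+ k = (m ^ k)%N by rewrite -!natz natrX.
rewrite !PoszX subzn ?expn_gt0 // -!PoszM.
(* This keeps the natural-number difference of cardinalities from being truncated. *)
have : (#|torus_zeros (fun j => tnth f j : {mpoly K[s]})| <= u.+1 ^ s)%N.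
  have <- : #|[set x : s.-tuple K | [forall i, tnth x i != 0]]| = (u.+1 ^ s)%N.
    by rewrite card_torus Ku.
  by apply/subset_leq_card/subsetP => x; rewrite !inE => /andP[].
by move=> tN; rewrite leq_subRL // => ?; rewrite lerBrDr -PoszD lez_nat.
Qed.
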